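(* Let $\Delta$ be a finite pure simplicial complex. Then the following are equivalent: (1) $\Delta$ admits projection maps satisfying the projection axioms (P1)–(P3); (2) $\Delta$ admits restriction maps satisfying the restriction axioms (R1)–(R3); (3) $\Delta$ admits partial orders satisfying the shelling axioms (S1)–(S3).
   Context: Let $\mathcal{F}$ be the set of faces of $\Delta$ (including the empty face $\emptyset$) and $\mathcal{C}$ the set of chambers (maximal faces). $F\le G$ means $F$ is a face of $G$; $G\lessdot D$ means $G$ is a codimension-one face of $D$. $\mathcal{C}_{\geq F}$ is the set of chambers containing $F$. A shelling of $\Delta$ (of dimension $d$) is a linear order $\le_S$ on $\mathcal{C}$ such that for every chamber $D$ other than the first, $D\cap\bigcup_{E<_SD}E$ is a nonempty union of codimension-one faces of $D$. Projection axioms (P): there is a map $\mathcal{F}\times\mathcal{C}\to\mathcal{C}$, $(F,C)\mapsto FC$, such that (P1)(i) if $FC=D$ then $F\le D$; (ii) if $F\le C$ then $FC=C$; (iii) if $FC=D$ and $F\le G\le D$ then $GC=D$. (P2) if $F\le D$ and $GC=D$ for all $G$ with $F\le G\lessdot D$, then $FC=D$. (P3) if $FC=D$ and $C_1,\dots,C_n=D$ is a weak $C$-gallery, then $FC_1=D$. Here a weak $C$-gallery is a sequence of chambers $C_1,\dots,C_n$ together with faces $F_1,\dots,F_{n-1}$ such that $F_iC=C_i$ and $F_i\le C_i$, $F_i\le C_{i+1}$ for each $i$. Restriction axioms (R): for every $C\in\mathcal{C}$ there is a map $R_C:\mathcal{C}\to\mathcal{F}$ such that (R1) $R_C(C)=\emptyset$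 and $R_C(D)\le D$ for all $C,D$; (R2) for every $C$, $\mathcal{F}$ is the disjoint union over $D\in\mathcal{C}$ of the sets $\{F\in\mathcal{F}: R_C(D)\le F\le D\}$; (R3) if $C_1,\dots,C_n=D$ are chambers with $R_C(C_i)\le C_{i+1}$ for $1\le i\le n-1$, then $R_{C_1}(D)\le R_C(D)\le D$. Shelling axioms (S): for every $C\in\mathcal{C}$ there is a partial order $\le_C$ on $\mathcal{C}$ such that (S1) for every $F\in\mathcal{F}$ the restriction of $\le_C$ to $\mathcal{C}_{\ge F}$ has a unique minimal element, which for $F=\emptyset$ is $C$; (S2) every linear extension of $\le_C$ is a shelling of $\Delta$; (S3) if $D\le_C D_1\le_C D_2$ then $D_1\le_D D_2$. *)

(* Defs.v *)
From HB Require Import structures.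
From mathcomp Require Import all_boot.

Set Implicit Arguments.
Unset Strict Implicit.
Unset Printing Implicit Defensive.

(* The empty face always belongs to a complex.  Elements of the ambient finite
   type V that lie in no face are allowed; they play no role. *)
Definition simplicial_complex (V : finType) (Delta : {set {set V}}) : Prop :=
  set0 \in Delta /\
  (forall F G : {set V}, G \in Delta -> F \subset G -> F \in Delta).

Definition is_chamber (V : finType) (Delta : {set {set V}}) : pred {set V} :=
  maxset [pred F : {set V} | F \in Delta].

Definition pure_complex (V : finType) (Delta : {set {set V}}) : Prop :=
  forall C D : {set V}, is_chamber Delta C -> is_chamber Delta D -> #|C| = #|D|.

Record face (V : finType) (Delta : {set {set V}}) :=
  Face { face_set :> {set V}; _ : face_set \in Delta }.

HB.instance Definition _ (V : finType) (Delta : {set {set V}}) :=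
  [isSub for @face_set V Delta].
HB.instance Definition _ (V : finType) (Delta : {set {set V}}) :=
  [Finite of face Delta by <:].

Record chamber (V : finType) (Delta : {set {set V}}) :=
  Chamber { chamber_set :> {set V}; _ : is_chamber Delta chamber_set }.

HB.instance Definition _ (V : finType) (Delta : {set {set V}}) :=
  [isSub for @chamber_set V Delta].
HB.instance Definition _ (V : finType) (Delta : {set {set V}}) :=
  [Finite of chamber Delta by <:].

Definition codim1 (V : finType) (G D : {set V}) : bool :=
  (G \subset D) && (#|D| == #|G|.+1).

Section Conditions.

Variables (V : finType) (Delta : {set {set V}}).

Notation face := (face Delta).
Notation chamber := (chamber Delta).

(* The sequence C1 :: s is a weak C-gallery from C1 to last C1 s when each
   consecutive pair (D, E) is joined by some face F. *)
Definition weak_gallery (p : face -> chamber -> chamber)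
    (C C1 : chamber) (s : seq chamber) : bool :=
  path (fun D E : chamber =>
    [exists F : face, [&& p F C == D, F \subset D & F \subset E]]) C1 s.

Definition axiom_P1 (p : face -> chamber -> chamber) : Prop :=
  [/\ forall (F : face) (C D : chamber), p F C = D -> F \subset D,
      forall (F : face) (C : chamber), F \subset C -> p F C = C &
      forall (F G : face) (C D : chamber),
        p F C = D -> F \subset G -> G \subset D -> p G C = D].

Definition axiom_P2 (p : face -> chamber -> chamber) : Prop :=
  forall (F : face) (C D : chamber), F \subset D ->
    (forall G : face, F \subset G -> codim1 G D -> p G C = D) ->
    p F C = D.

Definition axiom_P3 (p : face -> chamber -> chamber) : Prop :=
  forall (F : face) (C D C1 : chamber) (s : seq chamber),
    p F C = D -> weak_gallery p C C1 s -> last C1 s = D -> p F C1 = D.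

Definition projection_axioms (p : face -> chamber -> chamber) : Prop :=
  [/\ axiom_P1 p, axiom_P2 p & axiom_P3 p].

Definition restriction_interval (R : chamber -> chamber -> face)
    (C D : chamber) : {set face} :=
  [set F : face | (R C D \subset F) && (F \subset D)].

Definition axiom_R1 (R : chamber -> chamber -> face) : Prop :=
  (forall C : chamber, R C C = set0 :> {set V}) /\
  (forall C D : chamber, R C D \subset D).

Definition axiom_R2 (R : chamber -> chamber -> face) : Prop :=
  forall C : chamber,
    \bigcup_(D : chamber) restriction_interval R C D = [set: face] /\
    (forall D E : chamber, D != E ->
      [disjoint restriction_interval R C D & restriction_interval R C E]).

Definition axiom_R3 (R : chamber -> chamber -> face) : Prop :=
  forall (C D C1 : chamber) (s : seq chamber),
    path (fun E E' : chamber => R C E \subset E') C1 s -> last C1 s = D ->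
    R C1 D \subset R C D /\ R C D \subset D.

Definition restriction_axioms (R : chamber -> chamber -> face) : Prop :=
  [/\ axiom_R1 R, axiom_R2 R & axiom_R3 R].

Definition partial_order (le : rel chamber) : Prop :=
  [/\ reflexive le, antisymmetric le & transitive le].

Definition linear_order (le : rel chamber) : Prop :=
  partial_order le /\ total le.

Definition linear_extension (le S : rel chamber) : Prop :=
  linear_order S /\ (forall D E : chamber, le D E -> S D E).

(* Intersections and unions are taken between the subcomplexes generated by
   chambers and faces, that is, between their powersets. *)
Definition is_shelling (S : rel chamber) : Prop :=
  linear_order S /\
  (forall D : chamber, ~ (forall E : chamber, S D E) ->
    exists A : {set {set V}},
      [/\ A != set0,
          forall G : {set V}, G \in A -> codim1 G D &
          powerset D :&: \bigcup_(E : chamber | (E != D) && S E D) powerset E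
          = \bigcup_(G in A) powerset G]).

Definition is_minimal_above (le : rel chamber) (F : face) (D : chamber) : Prop :=
  F \subset D /\ (forall E : chamber, F \subset E -> le E D -> E = D).

Definition axiom_S1 (le : chamber -> rel chamber) : Prop :=
  forall C : chamber,
    (forall F : face, exists! D : chamber, is_minimal_above (le C) F D) /\
    (forall F : face, F = set0 :> {set V} -> is_minimal_above (le C) F C).

Definition axiom_S2 (le : chamber -> rel chamber) : Prop :=
  forall (C : chamber) (S : rel chamber),
    linear_extension (le C) S -> is_shelling S.

Definition axiom_S3 (le : chamber -> rel chamber) : Prop :=
  forall C D D1 D2 : chamber, le C D D1 -> le C D1 D2 -> le D D1 D2.

Definition shelling_axioms (le : chamber -> rel chamber) : Prop :=
  [/\ forall C : chamber, partial_order (le C),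
      axiom_S1 le, axiom_S2 le & axiom_S3 le].

End Conditions.

(* Main.v *)
(** Both the projections and the orders are recovered from the restriction
    maps: [FC = D] means [R_C(D) <= F <= D], and [<=_C] is the reflexive
    transitive closure of [R_C(D) <= E].  Antisymmetry of this closure comes
    from (R3): on a cycle, consecutive chambers [D, E] satisfy
    [R_E(D) <= R_C(D) <= E], so the face [D :&: E] lies both in
    [[R_E(D), D]] and in [[R_E(E), E] = [set0, E]], whence [D = E].
    Conversely [R_C(D)] consists of the vertices [v] of [D] such that [D :\ v]
    does not project to [D] (resp. such that [D] is not [<=_C]-least among the
    chambers containing [D :\ v]).  For the orders, the shelling condition says
    that a face of [D] contained in an earlier chamber lies in a
    codimension-one face of [D] with the same property. *)
Require Import Defs.
From mathcomp Require Import all_boot.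

Set Implicit Arguments.
Unset Strict Implicit.
Unset Printing Implicit Defensive.

(** * Linear extensions of finite partial orders *)

Lemma exists_linear_extension (T : finType) (le : rel T) :
  reflexive le -> antisymmetric le -> transitive le ->
  exists S : rel T, [/\ reflexive S, antisymmetric S, transitive S, total S &
    forall x y, le x y -> S x y].
Proof.
move=> le_refl le_anti le_tr.
pose down x := [set z | le z x].
(* A lexicographic key: first the size of the down-set, which grows strictly along [le], then
   [enum_rank], recovered modulo [#|T|], to break ties. *)
pose key x := #|down x| * #|T| + enum_rank x.
have key_inj : injective key.
  move=> x y /(congr1 (modn^~ #|T|)).
  by rewrite !modnMDl !modn_small ?ltn_ord // => /val_inj /enum_rank_inj.
exists (fun x y => key x <= key y); split.
- by move=> x.
- by move=> x y; rewrite -eqn_leq => /eqP /key_inj.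
- by move=> y x z; apply: leq_trans.
- by move=> x y; apply: leq_total.
move=> x y le_xy; have [-> // | neq_xy] := eqVneq x y.
have lt_xy : #|down x| < #|down y|.
  apply: proper_card; apply/properP; split.
    by apply/subsetP => z; rewrite !inE => /le_tr; apply.
  exists y; rewrite !inE ?le_refl //; apply: contra neq_xy => le_yx.
  by apply/eqP/le_anti; rewrite le_xy.
apply: (@leq_trans (#|down x|.+1 * #|T|)).
  by rewrite mulSn [leqRHS]addnC leq_add2l ltnW.
by apply: leq_trans (leq_addr _ _); rewrite leq_mul2r lt_xy orbT.
Qed.

(** * Faces of chambers and intervals of restriction maps *)

Section Complex.

Variables (V : finType) (Delta : {set {set V}}).
Hypothesis hDelta : simplicial_complex Delta.

Local Notation face := (face Delta).
Local Notation chamber := (chamber Delta).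

Implicit Types (F G : face) (C D E : chamber) (A : {set V}) (v : V).

Lemma chamber_in_complex C : (C : {set V}) \in Delta.
Proof. by case: C => C /= /maxsetp. Qed.

Fact inter_face_proof D A : D :&: A \in Delta.
Proof.
by case: hDelta => _; apply; [apply: chamber_in_complex D | apply: subsetIl].
Qed.

Definition inter_face D A : face := Face (inter_face_proof D A).

Lemma codim1_setD1 A v : v \in A -> codim1 (A :\ v) A.
Proof. by move=> vA; rewrite /codim1 subD1set [#|A|](cardsD1 v) vA /=. Qed.

Lemma codim1E (G A : {set V}) : codim1 G A -> exists2 v, v \in A & G = A :\ v.
Proof.
case/andP=> sGA /eqP cA.
have: #|A :\: G| = 1 by rewrite cardsD (setIidPr sGA) cA subSnn.
case/eqP/cards1P=> v AG; exists v.
  by have := set11 v; rewrite -AG inE => /andP[].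
by rewrite -AG setDDr setDv set0U (setIidPr sGA).
Qed.

Lemma restriction_cover R C F : axiom_R2 R ->
  exists D : chamber, R C D \subset F /\ F \subset D.
Proof.
move=> /(_ C)[cov _]; have : F \in [set: face] by rewrite inE.
rewrite -cov => /bigcupP[D _]; rewrite inE.
by case/andP; exists D.
Qed.

Lemma restriction_disjoint R C D E F : axiom_R2 R ->
  R C D \subset F -> F \subset D -> R C E \subset F -> F \subset E -> D = E.
Proof.
move=> /(_ C)[_ dis] RD FD RE FE; apply/eqP/negPn/negP => /dis /pred0P /(_ F).
by rewrite /= !inE RD FD RE FE.
Qed.

(** (R2) says that every face lies in exactly one interval, so it suffices that interval membership
    agrees with a functional relation. *)
Lemma restriction_axiom2_of_rel (R : chamber -> chamber -> face)
    (P : chamber -> face -> chamber -> Prop) :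
  (forall C F, exists! D, P C F D) ->
  (forall C F D, P C F D <-> R C D \subset F /\ F \subset D) ->
  axiom_R2 R.
Proof.
move=> uniqP PE C; split.
  apply/setP=> F; rewrite inE; have [D [PD _]] := uniqP C F.
  apply/bigcupP; exists D => //; rewrite inE.
  by apply/andP/PE.
move=> D E neq_DE; apply/pred0P => F /=; apply: contraNF neq_DE.
rewrite !inE => /andP[/andP/PE PD /andP/PE PE'].
by have [X [_ uX]] := uniqP C F; rewrite -(uX D PD) -(uX E PE').
Qed.

(** * From projections to restriction maps *)

Section ProjectionToRestriction.

Variable p : face -> chamber -> chamber.
Hypothesis hp : projection_axioms p.

Definition projection_restriction C D : face :=
  inter_face D [set v | p (inter_face D (~: [set v])) C != D].

(** If [F] omits a vertex [v] of [D], (P1)(iii) carries [p F C = D] over to [D :\ v], so [v] is not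
    in the restriction. Conversely, a codimension-one face of [D] above [F] omits a vertex outside
    [F], hence outside the restriction, and (P2) applies. *)
Lemma projection_restrictionP C F D :
  p F C = D <-> projection_restriction C D \subset F /\ F \subset D.
Proof.
have [[P1i P1ii P1iii] P2 _] := hp; split.
  move=> pF; have sFD := P1i _ _ _ pF; split=> //.
  apply/subsetP=> v; rewrite !inE => /andP[vD]; apply: contraR => vF.
  apply/eqP/(P1iii F) => //=; last exact: subsetIl.
  by rewrite -setDE subsetD1 sFD.
case=> sRF sFD; apply: P2 => // G sFG cGD.
have [v vD eG] := codim1E cGD.
have -> : G = inter_face D (~: [set v]) by apply/val_inj; rewrite /= -setDE.
apply/eqP/negPn/negP => npD.
have : v \in F by apply: (subsetP sRF); rewrite !inE vD.
by move/(subsetP sFG); rewrite eG !inE eqxx.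
Qed.

Lemma projection_restriction_axioms : restriction_axioms projection_restriction.
Proof.
have [[P1i P1ii P1iii] P2 P3] := hp.
have pR C D : p (projection_restriction C D) C = D.
  by apply/projection_restrictionP; split=> //; apply: subsetIl.
split.
- split=> [C | C D]; last exact: subsetIl.
  apply/setP => v; rewrite !inE; case: (v \in C) => //=.
  by rewrite P1ii ?eqxx //; apply: subsetIl.
- apply: (@restriction_axiom2_of_rel _ (fun C F D => p F C = D)).
    by move=> C F; exists (p F C); split.
  exact: projection_restrictionP.
move=> C D C1 s path_s last_s; split; last exact: subsetIl.
have [|//] := (projection_restrictionP C1 (projection_restriction C D) D).1.
(* The chain in (R3) is a weak [C]-gallery whose connecting faces are the restrictions. *)
apply: P3 (pR C D) _ last_s; apply: sub_path path_s => E E' sRE'.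
by apply/existsP; exists (projection_restriction C E); rewrite pR eqxx subsetIl.
Qed.

End ProjectionToRestriction.

(** * From restriction maps to projections *)

Section RestrictionTo.

Variable R : chamber -> chamber -> face.
Hypothesis hR : restriction_axioms R.

(** The default [C] is never reached: by (R2) exactly one chamber qualifies. *)
Definition restriction_projection F C : chamber :=
  odflt C [pick D : chamber | (R C D \subset F) && (F \subset D)].

Lemma restriction_projectionP C F D :
  restriction_projection F C = D <-> R C D \subset F /\ F \subset D.
Proof.
have [_ R2 _] := hR; rewrite /restriction_projection.
case: pickP => [E /andP[RE FE] | none] /=.
  split=> [<- // | [RD FD]]; exact: restriction_disjoint R2 RE FE RD FD.
by have [E [RE FE]] := restriction_cover C F R2; have := none E; rewrite RE FE.
Qed.

Lemma restriction_projection_axioms : projection_axioms restriction_projection.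
Proof.
have [[R1i R1ii] R2 R3] := hR; split.
- split=> [F C D /restriction_projectionP[] // | F C sFC | F G C D].
    by apply/restriction_projectionP; rewrite R1i sub0set.
  move=> /restriction_projectionP[sRF _] sFG sGD.
  by apply/restriction_projectionP; rewrite (subset_trans sRF).
- move=> F C D sFD allG; apply/restriction_projectionP; split=> //.
  (* If [v] in [R C D] were outside [F], then [D :\ v] would contain [F], hence project to [D] and
     contain [R C D]. *)
  apply/subsetP=> v vR; apply/negPn/negP => vF.
  have vD : v \in D by apply: (subsetP (R1ii C D)).
  have : restriction_projection (inter_face D (~: [set v])) C = D.
    by apply: allG; rewrite /= -setDE ?codim1_setD1 // subsetD1 sFD.
  by case/restriction_projectionP=> /subsetP/(_ v vR); rewrite !inE eqxx andbF.
move=> F C D C1 s /restriction_projectionP[sRF sFD] gal last_s.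
apply/restriction_projectionP; split=> //.
have [|sR _] := R3 C D C1 s _ last_s; last exact: subset_trans sR sRF.
apply: sub_path gal => E E' /existsP[G /and3P[/eqP pG _ sGE']].
by have [sRG _] := (restriction_projectionP C G E).1 pG; apply: subset_trans sRG _.
Qed.

(** * From restriction maps to partial orders *)

Definition restriction_order C : rel chamber :=
  connect (fun D E : chamber => R C D \subset E).

(** This is (R3) along a generating chain; it allows the base chamber to change from [C] to [D]. *)
Lemma restriction_order_sub C D E : restriction_order C D E -> R D E \subset R C E.
Proof.
have [_ _ R3] := hR.
by case/connectP=> s path_s last_s; have [] := R3 C E D s path_s (esym last_s).
Qed.

Lemma restriction_order_partial C : partial_order (restriction_order C).
Proof.
have [[R1i _] R2 _] := hR.
split; [exact: connect0 | move=> D E /andP[] | exact: connect_trans].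
(* Induction along the path: its first step is trivial because the rest of the cycle leads from [D']
   back to [D]. *)
case/connectP=> s path_s ->; elim: s D path_s => //= D' s IH D /andP[sRD' path_s].
move=> le_lastD.
have le_D'D : restriction_order C D' D.
  by apply: connect_trans le_lastD; apply/connectP; exists s.
suff eqD : D = D'.
  by move: le_lastD; rewrite eqD; apply: IH.
apply: (@restriction_disjoint R D' D D' (inter_face D D') R2) => //=.
- rewrite subsetI; apply/andP; split; first by have [[_ ->]] := hR.
  exact: subset_trans (restriction_order_sub le_D'D) sRD'.
- exact: subsetIl.
- by rewrite R1i sub0set.
- exact: subsetIr.
Qed.

(** The chamber whose interval contains [F] reaches every chamber above [F] in one step, so it is
    least there. *)
Lemma restriction_order_S1 : axiom_S1 restriction_order.
Proof.
have [[R1i _] R2 _] := hR.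
move=> C; have [_ anti _] := restriction_order_partial C.
have least F D : R C D \subset F -> forall E, F \subset E -> restriction_order C D E.
  by move=> sRF E sFE; apply: connect1; apply: subset_trans sRF sFE.
have minimal F D : R C D \subset F -> F \subset D ->
    is_minimal_above (restriction_order C) F D.
  move=> sRF sFD; split=> // E sFE le_ED; apply: anti.
  by rewrite le_ED (least F).
split=> F; last first.
  by move=> F0; apply: minimal; rewrite ?R1i F0 sub0set.
have [D [sRF sFD]] := restriction_cover C F R2.
exists D; split=> [|E [sFE minE]]; first exact: minimal.
by apply: minE => //; apply: least sFE.
Qed.

(** A face of [D] lies in an earlier chamber exactly when it misses some vertex [v] of [R C D], so
    the old part of [D] is the union of these [D :\ v]. *)
Lemma restriction_order_S2 : axiom_S2 restriction_order.
Proof.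
have [[_ R1ii] R2 _] := hR.
move=> C S [linS leS]; split=> // D notfirst.
have [[_ S_anti _] _] := linS.
have sub_old (F : {set V}) : F \subset D ->
    reflect (exists2 E : chamber, (E != D) && S E D & F \subset E)
      (~~ (R C D \subset F)).
  move=> sFD; apply: (iffP idP) => [nsRF | [E /andP[neq_ED SED] sFE]].
    have [E [/= sRE]] := restriction_cover C (inter_face D F) R2.
    rewrite (setIidPr sFD) in sRE *; move=> sFE; exists E => //.
    apply/andP; split; first by apply: contraNneq nsRF => <-.
    by apply/leS/connect1/(subset_trans sRE).
  apply: contra neq_ED => sRF; apply/eqP/S_anti; rewrite SED /=.
  by apply/leS/connect1/(subset_trans sRF).
exists [set (D : {set V}) :\ v | v in (R C D : {set V})]; split.
- have [R0|[v vR]] := set_0Vmem (R C D : {set V}); last first.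
    by apply/set0Pn; exists ((D : {set V}) :\ v); apply: imset_f.
  case: notfirst => E; apply/leS/connect1.
  by rewrite R0 sub0set.
- move=> G /imsetP[v vR ->]; apply: codim1_setD1; exact: (subsetP (R1ii C D)).
apply/setP => F; rewrite inE powersetE; apply/andP/bigcupP.
  case=> sFD /bigcupP[E oldE]; rewrite powersetE => sFE.
  have /(sub_old F sFD)/subsetPn[v vR vF] :
    exists2 E : chamber, (E != D) && S E D & F \subset E by exists E.
  exists ((D : {set V}) :\ v); first exact: imset_f.
  by rewrite powersetE subsetD1 sFD.
case=> G /imsetP[v vR ->]; rewrite powersetE subsetD1 => /andP[sFD vF].
split=> //; have [|E oldE sFE] := (sub_old F sFD) _.
  by apply/subsetPn; exists v.
by apply/bigcupP; exists E; rewrite ?powersetE.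
Qed.

(** Each step of the chain survives the change of base, since [R D D1] is contained in [R C D1]. *)
Lemma restriction_order_S3 : axiom_S3 restriction_order.
Proof.
move=> C D D1 D2 le_DD1 /connectP[s path_s ->].
elim: s D1 le_DD1 path_s => [|E s IH] D1 le_DD1 /=; first by move=> _; apply: connect0.
case/andP=> sRE path_s.
apply: (@connect_trans _ _ E); last first.
  by apply: IH => //; apply: connect_trans le_DD1 _; apply: connect1.
by apply: connect1; apply: subset_trans (restriction_order_sub le_DD1) sRE.
Qed.

Lemma restriction_order_axioms : shelling_axioms restriction_order.
Proof.
split; [exact: restriction_order_partial | exact: restriction_order_S1 |
  exact: restriction_order_S2 | exact: restriction_order_S3].
Qed.

End RestrictionTo.

(** * From partial orders to restriction maps *)

Section ShellingToRestriction.

Variable le : chamber -> rel chamber.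
Hypothesis hle : shelling_axioms le.

Definition is_least_above C A D : bool :=
  (A \subset D) && [forall E : chamber, (A \subset E) ==> le C D E].

Lemma is_least_aboveP C A D :
  reflect (A \subset D /\ forall E, A \subset E -> le C D E) (is_least_above C A D).
Proof.
apply: (iffP andP) => -[sAD lD]; split=> //.
  by move=> E sAE; apply: (implyP (forallP lD E)).
by apply/forallP => E; apply/implyP; apply: lD.
Qed.

(** By finiteness, below any [E] above [F] some chamber [Y] above [F] has a smallest down-set; it is
    minimal, so it is the unique minimal [D]. *)
Lemma minimal_above_least C F D :
  is_minimal_above (le C) F D -> is_least_above C F D.
Proof.
have [po S1 _ _] := hle; have [refl anti tr] := po C.
move=> minD; apply/is_least_aboveP; split=> [|E sFE]; first by case: minD.
have [X [_ uX]] := (S1 C).1 F.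
pose below (Y : chamber) := [set Z | le C Z Y].
pose Q := [pred Y : chamber | (F \subset Y) && le C Y E].
have QE : Q E by rewrite /= sFE refl.
case: (arg_minnP (fun Y => #|below Y|) QE) => Y /andP[sFY le_YE] minY.
suff: is_minimal_above (le C) F Y by move=> /uX eY; rewrite -(uX D minD) eY.
split=> // Z sFZ le_ZY.
have sub_ZY : below Z \subset below Y.
  by apply/subsetP=> W; rewrite !inE => /tr; apply.
have QZ : Q Z by rewrite /= sFZ (tr Y).
have : Y \in below Z.
  have /eqP-> : below Z == below Y by rewrite eqEcard sub_ZY minY.
  by rewrite inE refl.
by rewrite inE => le_YZ; apply: anti; rewrite le_ZY.
Qed.

Lemma exists_unique_least C F : exists! D, is_least_above C F D.
Proof.
have [po S1 _ _] := hle; have [_ anti _] := po C.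
have [D [minD _]] := (S1 C).1 F.
have leastD := minimal_above_least minD.
exists D; split=> // E leastE; apply: anti.
have [sFD lD] := is_least_aboveP _ _ _ leastD.
have [sFE lE] := is_least_aboveP _ _ _ leastE.
by rewrite lD ?lE.
Qed.

Lemma base_least C A : A \subset C -> is_least_above C A C.
Proof.
have [_ S1 _ _] := hle.
pose F0 : face := Face (proj1 hDelta).
have /minimal_above_least/is_least_aboveP[_ lC] := (S1 C).2 F0 erefl.
by move=> sAC; apply/is_least_aboveP; split=> // E _; apply: lC; apply: sub0set.
Qed.

Definition shelling_restriction C D : face :=
  inter_face D [set v | ~~ is_least_above C ((D : {set V}) :\ v) D].

(** For the converse, if the least chamber above [F] is not [D], it precedes [D] in a linear
    extension. The shelling puts [F] in some [D :\ v] that lies in an earlier chamber, so [v] is in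
    the restriction but not in [F]. *)
Lemma shelling_restrictionP C F D :
  is_least_above C F D <-> shelling_restriction C D \subset F /\ F \subset D.
Proof.
have [po _ S2 _] := hle; split.
  move=> /is_least_aboveP[sFD lD]; split=> //.
  apply/subsetP=> v; rewrite !inE => /andP[vD]; apply: contraR => vF.
  apply/is_least_aboveP; split=> [|E sE]; first exact: subD1set.
  by apply: lD; apply: subset_trans sE; rewrite subsetD1 sFD.
(* The first chamber [C] is treated apart, as the shelling condition says nothing about it. *)
case=> sRF sFD; have [eqDC | neq_DC] := eqVneq D C.
  by rewrite eqDC; apply: base_least; rewrite -eqDC.
have [refl anti tr] := po C.
have [S [S_refl S_anti S_tr S_tot leS]] := exists_linear_extension refl anti tr.
have [_ shellS] : is_shelling S by apply: (S2 C).
have notfirst : ~ forall E, S D E.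
  move=> firstD; case/eqP: neq_DC; apply: S_anti; rewrite firstD /=.
  apply: leS; have /is_least_aboveP[_] := base_least (sub0set C).
  by apply; apply: sub0set.
have [A [_ codimA /setP unionA]] := shellS D notfirst.
have [E [leastE _]] := exists_unique_least C F.
have [eqED | neq_ED] := eqVneq E D; first by rewrite -eqED.
have [sFE lE] := is_least_aboveP _ _ _ leastE.
have : (F : {set V}) \in \bigcup_(G in A) powerset G.
  rewrite -unionA inE powersetE sFD /=; apply/bigcupP.
  by exists E; rewrite ?powersetE // neq_ED leS ?lE.
case/bigcupP=> G GA; rewrite powersetE => sFG.
have [v vD eG] := codim1E (codimA G GA).
have : G \in \bigcup_(G in A) powerset G.
  by apply/bigcupP; exists G; rewrite ?powersetE.
rewrite -unionA inE => /andP[_ /bigcupP[E' /andP[neq_E'D SE'D]]].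
rewrite powersetE => sGE'.
have : v \in F.
  apply: (subsetP sRF); rewrite !inE vD /= -eG.
  apply: contra neq_E'D => /is_least_aboveP[_ lD].
  by apply/eqP/S_anti; rewrite SE'D leS ?lD.
by move/(subsetP sFG); rewrite eG !inE eqxx.
Qed.

Lemma shelling_restriction_axioms : restriction_axioms shelling_restriction.
Proof.
have [po _ _ S3] := hle.
have lR C D : is_least_above C (shelling_restriction C D) D.
  by apply/shelling_restrictionP; split=> //; apply: subsetIl.
split.
- split=> [C | C D]; last exact: subsetIl.
  apply/setP => v; rewrite !inE; case: (v \in C) => //=.
  by rewrite base_least // subD1set.
- exact: restriction_axiom2_of_rel exists_unique_least shelling_restrictionP.
move=> C D C1 s path_s last_s; split; last exact: subsetIl.
have [refl anti tr] := po C.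
have le_C1D : le C C1 D.
  rewrite -last_s; elim: s C1 path_s {last_s} => //= E s IH C1 /andP[sRE path_s].
  apply: tr (IH _ path_s).
  by have /is_least_aboveP[_] := lR C C1; apply.
have [|//] := (shelling_restrictionP C1 (shelling_restriction C D) D).1.
have [sRD lD] := is_least_aboveP _ _ _ (lR C D).
(* (S3) turns leastness of [D] for [C] into leastness for [C1]. *)
by apply/is_least_aboveP; split=> // E sRE; apply: S3 le_C1D (lD E sRE).
Qed.

End ShellingToRestriction.
End Complex.

Theorem theorem4p2 (V : finType) (Delta : {set {set V}})
    (hDelta : simplicial_complex Delta) (hpure : pure_complex Delta) :
  ((exists p : face Delta -> chamber Delta -> chamber Delta,
      projection_axioms p) <->
   (exists R : chamber Delta -> chamber Delta -> face Delta,
      restriction_axioms R)) /\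
  ((exists R : chamber Delta -> chamber Delta -> face Delta,
      restriction_axioms R) <->
   (exists le : chamber Delta -> rel (chamber Delta),
      shelling_axioms le)).
Proof.
split; split.
- by case=> p hp; exists (projection_restriction hDelta p);
    apply: projection_restriction_axioms.
- by case=> R hR; exists (restriction_projection R);
    apply: restriction_projection_axioms.
- by case=> R hR; exists (restriction_order R); apply: restriction_order_axioms.
by case=> le hle; exists (shelling_restriction hDelta le);
  apply: shelling_restriction_axioms.
Qed.
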